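(* Let $l\geq 2$ be an integer. There is no family of open subsets of the sphere $S^{2l-2}$ that covers $S^{2l-2}$, such that no member of the family contains a pair of antipodal points $x,-x$, and such that no point of $S^{2l-2}$ is contained in more than $l$ members of the family. Equivalently, for every even integer $h\geq 2$, the minimal number $Q(h)$ (defined below) equals $h/2+2$.
   Context: For integers $h\geq 0$ and $l\geq 1$, $Q(h,l)$ denotes the statement that $S^h$ can be covered by open sets none of which contains a pair of antipodal points, in such a way that no point of $S^h$ is contained in more than $l$ of these sets. $Q(h)$ denotes the minimal $l$ such that $Q(h,l)$ holds, i.e. the minimal $l$ such that $S^h$ can be covered by open sets not containing a pair of antipodal points with the intersection of any $l+1$ of them empty. *)

(* Defs.v *)
From HB Require Import structures.
From mathcomp Require Import all_boot all_order all_algebra.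
From mathcomp Require Import all_classical all_reals topology normedtype.

Set Implicit Arguments.
Unset Strict Implicit.
Unset Printing Implicit Defensive.

Import Order.TTheory GRing.Theory Num.Theory numFieldNormedType.Exports.

Local Open Scope classical_set_scope.
Local Open Scope card_scope.
Local Open Scope ring_scope.

(* As a type, [sphere R h] is the subtype [set_type (sphere R h)], whose
   topology is the one induced from R^(h+1). *)
Definition sphere (R : realType) (h : nat) : set 'rV[R]_h.+1 :=
  [set x | \sum_(i < h.+1) x ord0 i ^+ 2 = 1].

Arguments sphere : clear implicits.

Definition antipode_free (R : realType) (h : nat) (U : set (sphere R h)) : Prop :=
  forall x y : sphere R h, U x -> U y -> set_val y <> - set_val x.

(* The family [F] is arbitrary, possibly infinite. *)
Definition antipodal_cover (R : realType) (h l : nat)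
    (F : set (set (sphere R h))) : Prop :=
  [/\ forall U, F U -> open U,
      \bigcup_(U in F) U = [set: sphere R h],
      forall U, F U -> antipode_free U
    & forall x : sphere R h, [set U | F U /\ U x] #<= `I_l].

Definition Qprop (R : realType) (h l : nat) : Prop :=
  exists F : set (set (sphere R h)), antipodal_cover l F.

(* The default value 0 is not itself an admissible [l], so an equation
   [Qmin R h = n] with [0 < n] includes the existence of the minimum. *)
Definition Qmin (R : realType) (h : nat) : nat :=
  xget 0%N [set l | [/\ (1 <= l)%N, Qprop R h l &
                     forall m : nat, (1 <= m)%N -> Qprop R h m -> (l <= m)%N]].

(* Main.v *)
Require Import Defs.
From mathcomp Require Import all_boot all_order all_algebra.
From mathcomp Require Import all_classical all_reals topology normedtype.
From mathcomp Require Import zify ring lra.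

(** Lower bound. Suppose that a cover of S^(2l-2) has multiplicity at most l.
    Colour the points of a fine antipodally symmetric grid on the sphere by
    members of the cover: a small simplex s sees at most l colours, and s and -s
    see disjoint sets of colours. Over Z/2, let A be the cochain counting the
    splittings of a simplex into a front and a back face such that the colours
    of the front face and of the antipode of the back face alternate, starting
    at the front. If T is the antipode composed with reversal of the vertex
    order, then A + TA = dA, so that, as in Ky Fan's theorem, A evaluates to 1 on
    the fundamental cycle. In degree 2l-2 both faces have l vertices, and
    (l-1)-simplices weighted by their colour sets are cocycles because no
    l-simplex sees l+1 colours. As 0 < l-1 < 2l-2 (this is where l > 1 is used),
    these cocycles are coboundaries, hence so is A, and A evaluates to 0 on the
    fundamental cycle.

    Upper bound. On S^(2r) take 2r+2 linear forms with sum zero. The sets where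
    the i-th form exceeds a small level that at most r+1 forms reach, together
    with the set where at least r+2 forms are positive, form the cover. *)

Set Implicit Arguments.
Unset Strict Implicit.
Unset Printing Implicit Defensive.

Import Order.TTheory GRing.Theory Num.Theory numFieldNormedType.Exports.

Local Open Scope classical_set_scope.
Local Open Scope card_scope.
Local Open Scope ring_scope.

(* Decides identities in the group Z/2, which is [bool] here. *)
Ltac xor_find a :=
  lazymatch a with
  | ?x + ?y => first [xor_find x | xor_find y]
  | true => fail
  | false => fail
  | 0 => fail
  | _ => let b := fresh "b" in
         set b := a; clearbody b; destruct b
  end.
Ltac xor := repeat match goal with
  | |- ?l = ?r => first [xor_find l | xor_find r] end; reflexivity.

(** * Chains modulo 2 of tuples *)

Definition ev (T : Type) (f : T -> bool) (z : seq T) : bool :=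
  \sum_(t <- z) f t.

Section Evaluation.

Variable T : Type.
Implicit Types (f g : T -> bool) (z : seq T).

Lemma ev_nil f : ev f [::] = false. Proof. exact: big_nil. Qed.

Lemma ev_cons f t z : ev f (t :: z) = f t + ev f z.
Proof. exact: big_cons. Qed.

Lemma ev_cat f z z' : ev f (z ++ z') = ev f z + ev f z'.
Proof. exact: big_cat. Qed.

Lemma ev_map (W : Type) (c : W -> T) f (s : seq W) :
  ev f (map c s) = ev (fun t => f (c t)) s.
Proof. exact: big_map. Qed.

Lemma ev_flatten (W : Type) (c : W -> seq T) f (s : seq W) :
  ev f (flatten (map c s)) = ev (fun t => ev f (c t)) s.
Proof. by rewrite /ev big_flatten big_map. Qed.

Lemma evD f g z : ev (fun t => f t + g t) z = ev f z + ev g z.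
Proof. exact: big_split. Qed.

Lemma ev0 z : ev (fun=> false) z = false.
Proof. exact: big1. Qed.

Lemma eq_ev f g z : f =1 g -> ev f z = ev g z.
Proof. by move=> fg; apply: eq_bigr. Qed.

End Evaluation.

Lemma eq_in_ev (T : eqType) (f g : T -> bool) z :
  {in z, f =1 g} -> ev f z = ev g z.
Proof. by move=> fg; apply: eq_big_seq. Qed.

(** The only face of a one-vertex tuple is the empty tuple, so complexes are augmented and size k
    means dimension k - 1. *)
Fixpoint faces (T : Type) (t : seq T) : seq (seq T) :=
  if t is x :: t' then t' :: [seq x :: u | u <- faces t'] else [::].

Lemma faces_map (T W : Type) (b : T -> W) t :
  faces (map b t) = map (map b) (faces t).
Proof. by elim: t => //= x t ->; rewrite -!map_comp. Qed.

Section Chains.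

Variable V : eqType.
Implicit Types (t u : seq V) (z : seq (seq V)) (f g : seq V -> bool).

Definition bd z := flatten [seq faces t | t <- z].

Definition cob f t : bool := ev f (faces t).

(** A list stands for the sum of its tuples modulo 2; comparing evaluations lets repeated tuples
    cancel without a normal form. *)
Definition chain_eq z z' := forall f, ev f z = ev f z'.

Lemma ev_bd f z : ev f (bd z) = ev (cob f) z.
Proof. exact: ev_flatten. Qed.

Lemma cob_cons f x t : cob f (x :: t) = f t + cob (fun u => f (x :: u)) t.
Proof. by rewrite /cob /= ev_cons ev_map. Qed.

Lemma cob_nil f : cob f [::] = false. Proof. exact: ev_nil. Qed.

Lemma cobD f g t : cob (fun t => f t + g t) t = cob f t + cob g t.
Proof. exact: evD. Qed.

Lemma mem_faces_size t u : u \in faces t -> (size u).+1 = size t.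
Proof.
elim: t u => //= x t IH u; rewrite inE => /predU1P[->//|/mapP[w /IH <- ->]] //.
Qed.

Lemma mem_faces_subset t u : u \in faces t -> {subset u <= t}.
Proof.
elim: t u => //= x t IH u; rewrite inE => /predU1P[->|/mapP[w /IH wt ->]] y.
  by rewrite inE => ->; rewrite orbT.
by rewrite !inE => /predU1P[->|/wt->]; rewrite ?eqxx ?orbT.
Qed.

Lemma eq_cob f g t : f =1 g -> cob f t = cob g t.
Proof. exact: eq_ev. Qed.

Lemma eq_in_cob f g t :
  (forall u, size t = (size u).+1 -> {subset u <= t} -> f u = g u) ->
  cob f t = cob g t.
Proof.
move=> fg; apply: eq_in_ev => u ut; apply: fg; first by rewrite (mem_faces_size ut).
exact: mem_faces_subset ut.
Qed.

Lemma cob_map (W : eqType) (c : W -> V) f (s : seq W) :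
  cob f (map c s) = ev (fun u : seq W => f (map c u)) (faces s).
Proof. by rewrite /cob faces_map ev_map. Qed.

Lemma cob_cat f t u : cob f (t ++ u) =
  cob (fun t' => f (t' ++ u)) t + cob (fun u' => f (t ++ u')) u.
Proof.
elim: t f => [|x t IH] f; first by rewrite cob_nil; xor.
by rewrite /= !cob_cons IH; xor.
Qed.

Lemma cob_rev f t : cob f (rev t) = cob (fun u => f (rev u)) t.
Proof.
elim: t f => [|x t IH] f; first by rewrite !cob_nil.
rewrite rev_cons -cats1 cob_cat cob_cons cob_nil cats0.
rewrite cob_cons IH addrC; congr (_ + _); first by xor.
by apply: eq_cob => u; rewrite rev_cons cats1.
Qed.

Lemma cob0 t : cob (fun=> false) t = false.
Proof. exact: ev0. Qed.

Lemma cob_cob f t : cob (cob f) t = false.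
Proof.
elim: t f => [|x t IH] f; first exact: cob_nil.
rewrite cob_cons /cob (eq_ev _ (fun u => cob_cons f x u)).
by rewrite evD -/(cob f t) -/(cob (cob _) t) IH; xor.
Qed.

Lemma bd_bd z : chain_eq (bd (bd z)) [::].
Proof. by move=> f; rewrite !ev_bd ev_nil (eq_ev _ (cob_cob f)) ev0. Qed.

Lemma faces_subseq t u : u \in faces t -> subseq u t.
Proof.
elim: t u => //= x t IH u; rewrite inE => /predU1P[->|/mapP[w /IH wt ->]].
  exact: subseq_cons.
by rewrite eqxx.
Qed.

Lemma mem_bd z u : (u \in bd z) -> exists2 t, t \in z & u \in faces t.
Proof. by case/flattenP=> s /mapP[t tz ->] ut; exists t. Qed.

Lemma ev_pred1 t z : ev (pred1 t) z = odd (count_mem t z).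
Proof.
elim: z => [|u z IH]; first by rewrite ev_nil.
by rewrite ev_cons IH /= oddD oddb.
Qed.

(** Membership in a complex is asked of every listed tuple, so tuples that cancel modulo 2 must
    first be struck out. *)
Lemma mod2_reduce z :
  exists2 z', chain_eq z' z & forall t, t \in z' -> odd (count_mem t z).
Proof.
suff [z' uz' z'z]: exists2 z', uniq z' & chain_eq z' z.
  exists z' => // t tz'.
  by rewrite -ev_pred1 -z'z ev_pred1 count_uniq_mem // tz'.
elim: z => [|t z [z' uz' z'z]]; first by exists [::].
have [tz'|tz'] := boolP (t \in z'); last first.
  by exists (t :: z') => [|f]; rewrite /= ?tz' // !ev_cons z'z.
exists (rem t z'); first exact: rem_uniq.
move=> f; rewrite ev_cons -z'z /ev (perm_big _ (perm_to_rem tz')) big_cons /= -!/(ev _ _).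
by xor.
Qed.

(** * Prism homotopies and the filling of cycles *)

Fixpoint prism (a b : V -> V) t : seq (seq V) :=
  if t is x :: t' then
    (a x :: b x :: map b t') :: [seq a x :: u | u <- prism a b t']
  else [::].

(** Dual form of the homotopy identity: the boundary of the prism plus the prism of the boundary is
    the sum of the two end maps. *)
Lemma prism_homotopy a b f t :
  ev (cob f) (prism a b t) + ev (fun u => ev f (prism a b u)) (faces t)
  = f (map a t) + f (map b t).
Proof.
elim: t f => [|x t IH] f; first by rewrite !ev_nil /=; xor.
rewrite /= !ev_cons !ev_map !cob_cons (eq_ev _ (fun u => cob_cons f (a x) u)) evD.
under [X in _ + (_ + X)]eq_ev do rewrite /= ev_cons ev_map.
rewrite evD [cob _ (map b t)]/cob faces_map ev_map.
move: (IH (fun u => f (a x :: u))) => /=.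
set A := ev _ (prism a b t).
set B := ev _ (faces t) => IHx.
transitivity (f (a x :: map b t) + f (b x :: map b t) + (A + B)).
  by xor.
by rewrite IHx; xor.
Qed.

Implicit Type valid : seq V -> bool.

Definition chain_in valid k z := all (fun t => valid t && (size t == k)) z.

Definition cycle_chain z := chain_eq (bd z) [::].

(** Vanishing of the reduced homology in dimension k - 1 of the complex of [valid] tuples. *)
Definition fills valid k := forall z, chain_in valid k z -> cycle_chain z ->
  exists2 y, chain_in valid k.+1 y & chain_eq (bd y) z.

(** More than closure under faces: vertices may also be permuted and repeated, as prisms and
    reversals require. *)
Definition mem_closed valid :=
  forall t u, {subset u <= t} -> valid t -> valid u.

Lemma chain_in_cat valid k z z' :
  chain_in valid k (z ++ z') = chain_in valid k z && chain_in valid k z'.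
Proof. exact: all_cat. Qed.

Lemma chain_inP valid k z :
  reflect (forall t, t \in z -> valid t /\ size t = k) (chain_in valid k z).
Proof.
apply: (iffP allP) => zP t /zP; first by case/andP=> ? /eqP.
by case=> -> ->; rewrite eqxx.
Qed.

Lemma mem_prism a b t u : u \in prism a b t ->
  size u = (size t).+1 /\ {subset u <= map a t ++ map b t}.
Proof.
elim: t u => //= x t IH u; rewrite inE => /predU1P[->|/mapP[w /IH[wt ws] ->]].
  split; first by rewrite /= size_map.
  by move=> y; rewrite !(inE, mem_cat) => /or3P[]->; rewrite ?orbT.
split=> [|y]; first by rewrite /= wt.
rewrite !(inE, mem_cat) => /predU1P[->|/ws]; first by rewrite eqxx.
by rewrite mem_cat => /orP[]->; rewrite ?orbT.
Qed.

(** The prisms between consecutive maps [c M] and [c M.+1] are valid, and their boundaries telescope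
    on a cycle. *)
Lemma push_cycle valid (c : nat -> V -> V) :
    mem_closed valid ->
    (forall M t, valid t -> valid (map (c M.+1) t ++ map (c M) t)) ->
  forall k M z, chain_in valid k z -> cycle_chain z ->
  exists2 y, chain_in valid k.+1 y & forall f, ev f (bd y) =
    ev f (map (map (c M)) z) + ev f (map (map (c 0%N)) z).
Proof.
move=> vsub vc k M z zk zc; elim: M => [|M [y yk yE]].
  by exists [::] => // f; rewrite ev_nil; xor.
exists (flatten (map (prism (c M.+1) (c M)) z) ++ y).
  rewrite chain_in_cat yk andbT; apply/chain_inP=> u /flattenP[s /mapP[t tz ->]].
  move/chain_inP: zk => /(_ _ tz)[tv <-] /mem_prism[-> us]; split=> //.
  exact: vsub us (vc _ _ tv).
move=> f; rewrite ev_bd ev_cat -[ev _ y]ev_bd yE ev_flatten.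
under eq_ev => t.
  have -> : ev (cob f) (prism (c M.+1) (c M) t) =
    f (map (c M.+1) t) + f (map (c M) t) +
    cob (fun u => ev f (prism (c M.+1) (c M) u)) t.
    by rewrite -prism_homotopy /cob; xor.
  over.
by rewrite !evD -ev_bd zc ev_nil !ev_map; xor.
Qed.

(** A chain has finitely many vertices, so [c M] fixes all of them once M is large. *)
Lemma retract_cycle valid (c : nat -> V -> V) :
    mem_closed valid ->
    (forall M t, valid t -> valid (map (c M.+1) t ++ map (c M) t)) ->
    (forall x, exists M0, forall M, (M0 <= M)%N -> c M x = x) ->
  forall k z, chain_in valid k z -> cycle_chain z ->
  exists2 y, chain_in valid k.+1 y & forall f, ev f (bd y) =
    ev f z + ev f (map (map (c 0%N)) z).
Proof.
move=> vsub vc cid k z zk zc.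
have [M cM] : exists M, forall t, t \in z -> map (c M) t = t.
  suff [M cM] : exists M, forall x, x \in flatten z -> c M x = x.
    exists M => t tz; rewrite -[RHS]map_id; apply/eq_in_map=> x xt.
    by apply: cM; apply/flattenP; exists t.
  suff [M0 cM] : exists M0, forall x, x \in flatten z ->
    forall M, (M0 <= M)%N -> c M x = x by exists M0 => x /cM; apply.
  elim: (flatten z) => [|x s [M1 cM1]]; first by exists 0%N.
  have [M2 cM2] := cid x; exists (M1 + M2)%N => y.
  rewrite inE => /predU1P[->|ys] M leM; first by apply: cM2; lia.
  by apply: cM1 => //; lia.
have [y yk yE] := push_cycle vsub vc M zk zc.
exists y => // f; rewrite yE ev_map.
by congr (_ + _); apply: eq_in_ev => t /cM ->.
Qed.

Lemma map_cycle (c : V -> V) z : cycle_chain z -> cycle_chain (map (map c) z).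
Proof.
move=> zc f; rewrite ev_bd ev_map ev_nil.
rewrite (eq_ev _ (g := cob (fun u => f (map c u)))) -?ev_bd ?zc ?ev_nil //.
by move=> t; rewrite cob_map.
Qed.

Lemma cone_cycle valid p k z : cycle_chain z ->
    (forall t, t \in z -> valid (p :: t) /\ size t = k) ->
  exists2 y, chain_in valid k.+1 y & chain_eq (bd y) z.
Proof.
move=> zc zp; exists (map (cons p) z).
  by apply/chain_inP=> _ /mapP[t /zp[? tk] ->]; rewrite /= tk.
move=> f; rewrite ev_bd ev_map (eq_ev _ (cob_cons f p)) evD.
by rewrite -ev_bd zc ev_nil; xor.
Qed.

(** The maps [c M] deform a cycle into one supported at [p], which bounds its cone from [p]. *)
Lemma contractible_fills valid (c : nat -> V -> V) p :
    mem_closed valid -> valid [:: p] ->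
    (forall M t, valid t -> valid (map (c M.+1) t ++ map (c M) t)) ->
    (forall x, c 0%N x = p) ->
    (forall x, exists M0, forall M, (M0 <= M)%N -> c M x = x) ->
  forall k, fills valid k.
Proof.
move=> vsub vp vc c0 cid k z zk zc.
have [y yk yE] := retract_cycle vsub vc cid zk zc.
have [t|w wk wE] := @cone_cycle valid p k _ (map_cycle (c 0%N) zc).
  case/mapP=> u uz ->; rewrite size_map.
  move/chain_inP: zk => /(_ _ uz)[uv ->]; split=> //.
  apply: vsub vp => x; rewrite !inE => /predU1P[->//|/mapP[y' _ ->]].
  by rewrite c0.
exists (y ++ w); first by rewrite chain_in_cat yk.
by move=> f; rewrite ev_bd ev_cat -!ev_bd yE wE; xor.
Qed.

(** Acyclicity yields a contracting homotopy, bd H + H bd = id, by induction on size: t + H (bd t)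
    is a cycle, and [H t] is chosen to fill it. *)
Lemma contracting_operator valid n : mem_closed valid ->
    (forall k, (k < n)%N -> fills valid k) ->
  exists H : seq V -> seq (seq V), forall t, valid t -> (size t < n)%N ->
    chain_in valid (size t).+1 (H t) /\
    forall f, ev (cob f) (H t) + cob (fun u => ev f (H u)) t = f t.
Proof.
move=> vsub; elim: n => [|n IH] vfill; first by exists (fun=> [::]).
have [H HP] := IH (fun k kn => vfill k (ltnW kn)).
have /choice[H' H'P] : forall t, exists y, valid t -> size t = n ->
    chain_in valid n.+1 y /\
    forall f, ev (cob f) y + cob (fun u => ev f (H u)) t = f t.
  move=> t; have [tv|] := boolP (valid t); last by exists [::].
  have [tn|tn] := eqVneq (size t) n; last by exists [::] => _ /eqP; rewrite (negPf tn).
  have facesP u : u \in faces t -> valid u /\ (size u).+1 = n.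
    by move=> ut; rewrite (mem_faces_size ut) (vsub _ _ (mem_faces_subset ut)).
  have [||y yk yE] := vfill n (ltnSn n) (t :: flatten (map H (faces t))) => //.
  - rewrite /chain_in /= tv tn eqxx; apply/chain_inP => w.
    case/flattenP=> s /mapP[u /facesP[uv un] ->].
    have [|/chain_inP Hu _] := HP u uv; first by lia.
    by move=> /Hu; rewrite un.
  - move=> f; rewrite ev_bd ev_cons ev_nil ev_flatten.
    rewrite (@eq_in_ev _ _ (fun u => f u + cob (fun w => ev f (H w)) u)); last first.
      move=> u /facesP[uv un]; have [|_ Hu] := HP u uv; first by lia.
      by rewrite -[in RHS](Hu f); xor.
    rewrite evD -/(cob f t) -/(cob (cob _) t) cob_cob; xor.
  exists y => _ _; split=> // f.
  rewrite -ev_bd yE ev_cons ev_flatten -/(cob _ t); xor.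
exists (fun t => if size t == n then H' t else H t) => t tv.
rewrite ltnS leq_eqVlt => /predU1P[tn|tn]; last first.
  have [Ht HtE] := HP t tv tn; rewrite ltn_eqF //; split=> // f.
  rewrite -[RHS](HtE f); congr (_ + _); apply: eq_in_ev => u /mem_faces_size un.
  by rewrite ltn_eqF //; lia.
have [Ht HtE] := H'P t tv tn; rewrite tn eqxx; split=> // f.
rewrite -[RHS](HtE f); congr (_ + _); apply: eq_in_ev => u /mem_faces_size un.
by rewrite ltn_eqF //; lia.
Qed.

End Chains.
(** * Alternating colourings *)

Fixpoint alternating (b : bool) (w : seq bool) : bool :=
  if w is c :: w' then (c == b) && alternating (~~ b) w' else true.

(** In an alternating word exactly one deletion, at an end, leaves a word alternating from [b]. A
    word that is not alternating but has an alternating face has one repeated pair of neighbours,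
    and the two deletions there cancel. *)
Lemma alternating_faces b w :
  cob (alternating b) w = alternating b w + alternating (~~ b) w.
Proof.
elim: w b => [|c w IH] b; first by rewrite cob_nil /=; xor.
rewrite cob_cons /=; case: eqVneq => [->|cb].
  rewrite (eq_cob (g := alternating (~~ b))) ?eqxx // IH negbK.
  by case: b => /=; xor.
have -> : c = ~~ b by case: c b cb => [] [].
rewrite eqxx negbK (eq_cob (g := fun=> false)) ?cob0 => [|u].
  by case: b {cb} => /=; xor.
by case: b {cb}.
Qed.

Lemma alternating_map_negb b w :
  alternating b (map negb w) = alternating (~~ b) w.
Proof. by elim: w b => //= c w IH b; rewrite IH; case: c b => [] []. Qed.

Lemma alternating_count b w :
  alternating b w -> (count id w).*2 = (size w + (b && odd (size w)) - (~~ b && odd (size w)))%N.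
Proof.
elim: w b => [|c w IH] b /=; first by rewrite !andbF.
by case/andP=> /eqP-> /IH; case: b => /=; lia.
Qed.

(* The letter at colour [c] is coded by [c.*2.+1] or [c.*2], and words are
   read off in increasing order of the codes. *)
Definition alt_codes b (s : seq nat) := alternating b (map odd (sort leq s)).

Lemma perm_alt_codes b s s' : perm_eq s s' -> alt_codes b s = alt_codes b s'.
Proof.
move=> ss'; rewrite /alt_codes; congr (alternating _ (map _ _)).
exact/(perm_sortP leq_total leq_trans anti_leq).
Qed.

(** Equal codes would be neighbours in sorted order and carry the same letter. *)
Lemma alt_codes_uniq b s : alt_codes b s -> uniq s.
Proof.
rewrite -(sort_uniq leq) /alt_codes => alts.
suff: sorted ltn (sort leq s) by rewrite ltn_sorted_uniq_leq => /andP[].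
move: alts (sort_sorted leq_total s); elim: (sort leq s) b => //= x t IH b.
case/andP=> /eqP ox; case: t IH => //= y t IH alt_yt /andP[xy ty].
rewrite (IH (~~ b)) // andbT ltn_neqAle xy andbT.
move: alt_yt => /andP[/eqP oy _]; apply: contra_eq_neq oy => <-.
by rewrite ox; case: (b).
Qed.

(** * Coboundaries of permutation-invariant cochains *)

Section PermFaces.

Variables (T : eqType) (f : seq T -> bool).

Lemma cob_rem s : (forall t t', perm_eq t t' -> f t = f t') ->
  cob f s = ev (fun x => f (rem x s)) s.
Proof.
elim: s f => [|x s IH] g gperm; first by rewrite cob_nil ev_nil.
rewrite cob_cons ev_cons /= eqxx IH => [|t t' tt']; last first.
  by apply: gperm; rewrite perm_cons.
congr (_ + _); apply: eq_in_ev => y ys; apply: gperm.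
case: eqVneq => [->|//]; rewrite perm_sym; exact: perm_to_rem.
Qed.

Lemma perm_cob s s' : (forall t t', perm_eq t t' -> f t = f t') ->
  perm_eq s s' -> cob f s = cob f s'.
Proof.
move=> fperm ss'; rewrite !cob_rem // /ev (perm_big _ ss').
apply: eq_bigr => x _; apply: fperm.
by apply/permP=> a; rewrite !count_rem (perm_mem ss') (permP ss').
Qed.

(** With a repeated entry moved to the front, the two faces dropping one copy cancel, and every
    other face still repeats it. *)
Lemma cob_repeated s : (forall t t', perm_eq t t' -> f t = f t') ->
  (forall t, f t -> uniq t) -> ~~ uniq s -> cob f s = false.
Proof.
move=> fperm funiq sN.
have [x [t st]] : exists x t, perm_eq s [:: x, x & t].
  elim: s sN => //= x s IH; rewrite negb_and negbK => /orP[xs|/IH[y [t st]]].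
    by exists x, (rem x s); rewrite perm_cons perm_to_rem.
  exists y, (x :: t); rewrite -(perm_cons x) in st.
  apply: perm_trans st _.
  by rewrite (perm_catCA [:: x] [:: y; y] t).
rewrite (perm_cob fperm st) !cob_cons (eq_cob (g := fun=> false)) ?cob0.
  by xor.
by move=> u; apply/negbTE/negP => /funiq; rewrite /= inE eqxx.
Qed.

End PermFaces.

Lemma cob_alt_codes s b :
  cob (alt_codes b) s = alt_codes b s + alt_codes (~~ b) s.
Proof.
rewrite [in RHS]/alt_codes -alternating_faces.
rewrite (perm_cob (@perm_alt_codes b) (s' := sort leq s)); last first.
  by rewrite perm_sym perm_sort.
rewrite [RHS]/cob faces_map ev_map; apply: eq_in_ev => u us.
rewrite /alt_codes sorted_sort //; first exact: leq_trans.
apply: (subseq_sorted leq_trans) (sort_sorted leq_total s).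
exact: faces_subseq us.
Qed.

(** * Front-back products *)

Section FrontBack.

Variable V : eqType.
Implicit Types (t a b : seq V) (G : seq V -> seq V -> bool).

(* The value at [t] of the pullback of [G] along the Alexander-Whitney
   diagonal: the sum of [G (take p.+1 t) (drop p t)] over [p < size t]. *)
Fixpoint front_back G t : bool :=
  if t is x :: t' then G [:: x] t + front_back (fun a b => G (x :: a) b) t'
  else false.

Lemma eq_front_back G G' t :
  (forall a b, (size a + size b = (size t).+1)%N -> {subset a <= t} ->
    {subset b <= t} -> G a b = G' a b) ->
  front_back G t = front_back G' t.
Proof.
elim: t G G' => //= x t IH G G' GG'; congr (_ + _).
  by apply: GG' => //= y; rewrite !inE => ->.
apply: IH => a b ab sa sb; apply: GG' => [|y|y /sb]; first by rewrite /=; lia.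
  by rewrite !inE => /predU1P[->|/sa->]; rewrite ?eqxx ?orbT.
by rewrite inE => ->; rewrite orbT.
Qed.

Lemma front_backD G G' t :
  front_back (fun a b => G a b + G' a b) t = front_back G t + front_back G' t.
Proof. by elim: t G G' => [|x t IH] G G' /=; rewrite ?IH; xor. Qed.

Lemma front_back_rcons G t x : front_back G (rcons t x) =
  front_back (fun a b => G a (rcons b x)) t + G (rcons t x) [:: x].
Proof. by elim: t G => [|y t IH] G /=; rewrite ?IH; xor. Qed.

Lemma front_back_rev G t :
  front_back G (rev t) = front_back (fun a b => G (rev b) (rev a)) t.
Proof.
elim: t G => //= x t IH G.
rewrite rev_cons front_back_rcons IH addrC -rev_cons; congr (_ + _).
by apply: eq_front_back => a b _ _ _; rewrite rev_cons.
Qed.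

Lemma front_back_map (c : V -> V) G t :
  front_back G (map c t) = front_back (fun a b => G (map c a) (map c b)) t.
Proof. by elim: t G => //= x t IH G; rewrite IH. Qed.

(** Leibniz rule: on the right, the deletions of the vertex shared by front and back telescope to
    the two extreme terms. *)
Lemma cob_front_back G t : cob (front_back G) t =
  front_back (fun a b => cob (G^~ b) a + cob (G a) b) t + G [::] t + G t [::].
Proof.
elim: t G => [|x t IH] G; first by rewrite cob_nil /=; xor.
rewrite cob_cons cobD IH /= !cob_cons cob_nil.
have -> : front_back (fun a b => cob (G^~ b) (x :: a) + cob (G (x :: a)) b) t =
    front_back G t +
    front_back (fun a b => cob (fun c => G (x :: c) b) a + cob (G (x :: a)) b) t.
  rewrite -front_backD; apply: eq_front_back => a b _ _ _.
  by rewrite cob_cons; xor.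
by xor.
Qed.

End FrontBack.

(** * Ky Fan's cochain of an antipodal colouring *)

Section AntipodalColoring.

Variables (V : eqType) (valid : seq V -> bool) (opp : V -> V) (color : V -> nat).
Variable l : nat.
Hypothesis oppK : involutive opp.
Hypothesis valid_sub : mem_closed valid.
Hypothesis valid_opp : forall t, valid t -> valid (map opp t).
Hypothesis color_opp : forall t x y, valid t -> x \in t -> y \in t ->
  color x <> color (opp y).
Hypothesis color_repeated : forall t, valid t -> size t = l.+1 ->
  ~~ uniq (map color t).

Definition front_code v := (color v).*2.+1.
Definition back_code v := (color (opp v)).*2.

Definition codes (a b : seq V) := map front_code a ++ map back_code b.

(** For [b] true this is the cochain A of the overview, odd codes being the front letters; [flip] is
    its map T. *)
Definition fan b := front_back (fun u v : seq V => alt_codes b (codes u v)).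

Definition flip t := rev (map opp t).

Lemma valid_flip t : valid t -> valid (flip t).
Proof. by move=> tv; apply: valid_sub (valid_opp tv) => x; rewrite mem_rev. Qed.

Lemma flipK : involutive flip.
Proof. by move=> t; rewrite /flip map_rev revK (mapK oppK). Qed.

Lemma cob_flip f t : cob f (flip t) = cob (fun u => f (flip u)) t.
Proof. by rewrite /flip cob_rev cob_map. Qed.

Definition swap_code c := if odd c then c.-1 else c.+1.

(** No colour carries both of its codes, so swapping the two codes of each colour keeps the sorted
    order and only negates letters. *)
Lemma alt_codes_swap b (s : seq nat) :
  {in s &, forall c d, c./2 = d./2 -> c = d} ->
  alt_codes b (map swap_code s) = alt_codes (~~ b) s.
Proof.
move=> s_inj; rewrite /alt_codes.
have -> : sort leq (map swap_code s) = map swap_code (sort leq s).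
  apply: (sorted_eq leq_trans anti_leq); first exact: sort_sorted leq_total _.
    apply: (homo_sorted_in (P := mem s) (e := leq)) (sort_sorted leq_total s).
      move=> c d cs ds cd; have := s_inj c d cs ds.
      by rewrite /swap_code; case: ifP; case: ifP; lia.
    by apply/allP=> c; rewrite mem_sort.
  by rewrite perm_sort perm_map // perm_sym perm_sort.
rewrite -alternating_map_negb -!map_comp; congr (alternating _ _).
by apply: eq_map => c /=; rewrite /swap_code; case: ifP; lia.
Qed.

(** Reversal exchanges fronts and backs, and the antipode turns a front code into the back code of
    the same colour and conversely, so each letter is negated. *)
Lemma fan_flip b t : valid t -> fan b (flip t) = fan (~~ b) t.
Proof.
move=> tv; rewrite /fan /flip front_back_rev front_back_map.
apply: eq_front_back => u v _ ut vt.
rewrite -alt_codes_swap; last first.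
  have codeP c : c \in codes u v ->
    exists2 x, x \in t & c = front_code x \/ c = back_code x.
    rewrite mem_cat => /orP[/mapP[x /ut xt ->]|/mapP[x /vt xt ->]].
      by exists x; [|left].
    by exists x; [|right].
  move=> c d /codeP[x xt cx] /codeP[y yt dy].
  have := color_opp tv xt yt; have := color_opp tv yt xt.
  by move: cx dy; rewrite /front_code /back_code => -[]-> []->; lia.
have frontE : map front_code (rev (map opp v)) =
    rev (map swap_code (map back_code v)).
  rewrite map_rev -!map_comp; congr rev; apply: eq_map => x /=.
  by rewrite /swap_code /front_code /back_code odd_double.
have backE : map back_code (rev (map opp u)) =
    rev (map swap_code (map front_code u)).
  rewrite map_rev -!map_comp; congr rev; apply: eq_map => x /=.
  by rewrite /swap_code /front_code /back_code /= odd_double oppK.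
apply: perm_alt_codes.
by rewrite /codes frontE backE map_cat perm_catC perm_cat // perm_rev.
Qed.

(** In the Leibniz rule, [cob_alt_codes] produces the words with the other starting letter, which
    [fan_flip] moves to [flip t]. The last two terms have an empty front or back. *)
Lemma cob_fan b t : valid t -> cob (fan b) t =
  fan b t + fan b (flip t) + alt_codes b (map back_code t) + alt_codes b (map front_code t).
Proof.
move=> tv; rewrite fan_flip // -front_backD /fan cob_front_back.
rewrite {3 4}/codes /= cats0; congr (_ + _ + _).
apply: eq_front_back => u v _ _ _.
by rewrite -cob_alt_codes /codes cob_cat !cob_map.
Qed.

Lemma alt_codes_const b c s : all (fun i => odd i == c) s ->
  alt_codes b s = alternating b (nseq (size s) c).
Proof.
move=> sc; rewrite /alt_codes; congr (alternating _ _).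
rewrite -(size_sort leq) -(size_map odd); apply/all_pred1P/allP=> _ /mapP[x + ->].
by rewrite mem_sort => /(allP sc).
Qed.

(** The extreme words in [cob_fan] repeat a single letter at least twice, so they do not
    alternate. *)
Lemma fan_boundary t : valid t -> (1 < size t)%N ->
  fan true t + fan true (flip t) = cob (fan true) t.
Proof.
move=> tv t1; rewrite cob_fan // (@alt_codes_const _ false); last first.
  by apply/allP=> _ /mapP[x _ ->]; rewrite odd_double.
rewrite (@alt_codes_const _ true); last first.
  by apply/allP=> _ /mapP[x _ ->]; rewrite /= odd_double.
by rewrite !size_map; case: (size t) t1 => [|[|m]] //= _; xor.
Qed.

(** A single front letter does alternate: this is the 1 that starts Ky Fan's induction. *)
Lemma fan_seq1 x : valid [:: x] ->
  fan true [:: x] + fan true (flip [:: x]) = true.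
Proof.
move=> xv; have := cob_fan true xv; rewrite cob_cons cob_nil /=.
rewrite (@alt_codes_const _ false) /= ?odd_double //.
rewrite (@alt_codes_const _ true) /= ?odd_double //.
have -> : fan true [::] = false by [].
by case: (fan true _) (fan true _) => [] [].
Qed.

Lemma double_cycle y z : chain_eq (bd y) (z ++ map flip z) ->
  cycle_chain (y ++ map flip y).
Proof.
move=> yE f; rewrite ev_bd ev_cat ev_map.
rewrite (eq_ev y (cob_flip f)) -!ev_bd !yE ev_nil !ev_cat !ev_map.
rewrite [ev (fun t => f (flip (flip t))) z](eq_ev (g := f)) => [|t].
  by xor.
by rewrite flipK.
Qed.

(** Ky Fan's induction: fill the previous cycle by a hemisphere y and add its flip. By
    [fan_boundary] the value on the sum is the value on the boundary of y, which is the previous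
    cycle. *)
Lemma odd_fan_cycle n v k :
    (forall k, (k < n)%N -> fills valid k) -> valid [:: v] -> (k < n)%N ->
  exists2 y, chain_in valid k.+1 y &
    cycle_chain (y ++ map flip y) /\ ev (fan true) (y ++ map flip y).
Proof.
move=> vfill vv; elim: k => [_|k IH kn].
  exists [:: [:: v]]; first by rewrite /chain_in /= vv.
  split=> [f|].
    by rewrite ev_bd /= -[flip _]/[:: opp v] !ev_cons !cob_cons !cob_nil !ev_nil; xor.
  by rewrite /is_true -[RHS](fan_seq1 vv) /= !ev_cons ev_nil; xor.
have [z zk [zc zfan]] := IH (ltnW kn).
have [||y yk yE] := vfill _ kn (z ++ map flip z) => //.
  rewrite chain_in_cat zk; apply/chain_inP => _ /mapP[t tz ->].
  move/chain_inP: zk => /(_ _ tz)[/valid_flip-> <-].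
  by rewrite /flip size_rev size_map.
exists y => //; split; first exact: double_cycle yE.
rewrite ev_cat ev_map -evD.
rewrite (eq_in_ev (g := cob (fan true))) -?ev_bd ?yE // => t.
by move/chain_inP: yk => /[apply] -[tv tk]; rewrite fan_boundary ?tk.
Qed.

(** An alternating word of even length has as many front letters as back letters. *)
Lemma fan_balanced u w : size u != size w -> (size u + size w)%N = l.*2 ->
  alt_codes true (codes u w) = false.
Proof.
move=> uw uwl; apply: contraNF uw => /alternating_count.
rewrite size_map size_sort size_cat !size_map uwl odd_double count_map.
rewrite (permP (permEl (perm_sort leq _))) count_cat !count_map /=.
rewrite (eq_count (a2 := xpredT)); last by move=> x /=; rewrite odd_double.
rewrite (eq_count (a1 := preim back_code _) (a2 := pred0)); last first.
  by move=> x /=; rewrite odd_double.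
by rewrite count_predT count_pred0; lia.
Qed.

Lemma cob_repeated_front u w : ~~ uniq (map color u) ->
  cob (fun t => alt_codes true (codes t w)) u = false.
Proof.
move=> uN.
pose f s := alt_codes true (s ++ map back_code w).
have -> : cob (fun t => alt_codes true (codes t w)) u = cob f (map front_code u).
  by rewrite cob_map.
apply: cob_repeated => [t t' tt'|t /alt_codes_uniq|].
- by apply: perm_alt_codes; rewrite perm_cat2r.
- by rewrite cat_uniq => /andP[].
- have frontE : map front_code u = map (fun c => c.*2.+1) (map color u).
    by rewrite -map_comp.
  by rewrite frontE map_inj_uniq // => c d []; lia.
Qed.

Lemma cob_repeated_back u w : ~~ uniq (map color (map opp w)) ->
  cob (fun t => alt_codes true (codes u t)) w = false.
Proof.
move=> wN.
pose f s := alt_codes true (map front_code u ++ s).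
have -> : cob (fun t => alt_codes true (codes u t)) w = cob f (map back_code w).
  by rewrite cob_map.
apply: cob_repeated => [t t' tt'|t /alt_codes_uniq|].
- by apply: perm_alt_codes; rewrite perm_cat2l.
- by rewrite cat_uniq => /and3P[].
- have backE : map back_code w = map double (map color (map opp w)).
    by rewrite -!map_comp.
  by rewrite backE map_inj_uniq // => c d; lia.
Qed.

(* In degree [l.-1] the colours of a tuple give a cocycle, so the contracting
   operator makes it a coboundary and the front-back product exact. *)
Lemma fan_coboundary H : (1 < l)%N ->
    (forall t, valid t -> (size t < l.+1)%N ->
      chain_in valid (size t).+1 (H t) /\
      forall f, ev (cob f) (H t) + cob (fun u => ev f (H u)) t = f t) ->
  exists g, forall t, valid t -> (size t).+1 = l.*2 -> fan true t = cob g t.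
Proof.
move=> l1 HP.
pose e u w := alt_codes true (codes u w).
(* [H] raises a front of size l - 1 to size l, to be paired with a back of size l. *)
pose G u w := [&& (size u).+1 == l, size w == l & ev (e^~ w) (H u)].
exists (front_back G) => t tv tl; rewrite cob_front_back.
(* An empty front would need l = 1, excluded by [1 < l]. *)
have -> : G [::] t = false by rewrite /G ltn_eqF.
have -> : G t [::] = false by rewrite /G /= (ltn_eqF (ltnW l1)) andbF.
transitivity (front_back (fun a b => cob (G^~ b) a + cob (G a) b) t); last by xor.
apply: eq_front_back => a b ab at_ bt.
have av : valid a by apply: valid_sub at_ tv.
have bv : valid b by apply: valid_sub bt tv.
(* Only a back of size l + 1 matters here, and its antipodes repeat a colour. *)
have -> : cob (G a) b = false.
  have [al|al] := eqVneq (size a).+1 l; last first.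
    by rewrite (eq_cob (g := fun=> false)) ?cob0 // => w; rewrite /G (negPf al).
  rewrite (eq_in_cob (g := fun w => ev (e^~ w) (H a))); last first.
    by move=> w bw _; rewrite /G al eqxx /=; case: eqP => //; lia.
  rewrite /cob /ev exchange_big /= -[RHS](ev0 (H a)).
  apply: eq_in_ev => u uH; apply: cob_repeated_back.
  by apply: color_repeated; [exact: valid_opp | rewrite size_map; lia].
have [al|al] := eqVneq (size a) l; last first.
  rewrite fan_balanced; [|by lia..].
  rewrite (eq_in_cob (g := fun=> false)) ?cob0 // => u ua _.
  by rewrite /G -ua (negPf al).
have [|Ha HaE] := HP a av; first by rewrite al.
rewrite (eq_in_cob (g := fun u => ev (e^~ b) (H u))); last first.
  by move=> u ua _; rewrite /G -ua al eqxx /=; case: eqP => //; lia.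
(* In the homotopy identity the term on [H a] vanishes: its tuples have size l + 1 and repeat a
   colour. *)
rewrite -[LHS](HaE (e^~ b)) (eq_in_ev (g := fun=> false)) ?ev0; first by xor.
move=> u; move/chain_inP: Ha => /[apply] -[uv ul].
by apply: cob_repeated_front; apply: color_repeated; rewrite // ul al.
Qed.

Lemma no_antipodal_coloring v : (1 < l)%N -> valid [:: v] ->
  ~ forall k, (k.+1 < l.*2)%N -> fills valid k.
Proof.
move=> l1 vv vfill.
have {}vfill k : (k < l.*2.-1)%N -> fills valid k by move=> ?; apply: vfill; lia.
have [H HP] := contracting_operator valid_sub vfill.
(* The homotopy is needed up to size l, and l < 2l - 1 because [1 < l]. *)
have [t tv tl|g gP] := @fan_coboundary H l1; first by apply: HP => //; lia.
have [|y yk [yc]] := odd_fan_cycle vfill vv (k := l.*2.-2); first by lia.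
rewrite (eq_in_ev (g := cob g)) -?ev_bd ?yc ?ev_nil // => t.
have flipP u : u \in y -> valid u /\ (size u).+1 = l.*2.
  by move/chain_inP: yk => /[apply] -[-> ->]; split=> //; lia.
rewrite mem_cat => /orP[/flipP[tv tl]|/mapP[u /flipP[uv ul] ->]]; apply: gP => //.
  exact: valid_flip.
by rewrite /flip size_rev size_map.
Qed.

End AntipodalColoring.

(** * The grid sphere *)

Definition clamp (p : int) (M : nat) (x : int) : int :=
  Num.max (p - M%:Z) (Num.min (p + M%:Z) x).

Lemma clamp0 p x : clamp p 0 x = p. Proof. by rewrite /clamp; lia. Qed.

Lemma clamp_id p M x : (`|x - p| <= M)%N -> clamp p M x = x.
Proof. by rewrite /clamp; lia. Qed.

Lemma min_shift_id (N x : int) (M : nat) :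
  (`|(x + N)%R| <= M)%N -> Num.min x (M%:Z - N) = x.
Proof. by lia. Qed.

Section Grid.

Variable n : nat.
Local Notation point := 'rV[int]_n.
Implicit Types (x y p : point) (t : seq point) (i : 'I_n) (B : pred point).

Definition adjacent x y := [forall i, `|x ord0 i - y ord0 i| <= 1].

Definition clique t := allrel adjacent t t.

Lemma adjacentP x y : reflect (forall i, `|x ord0 i - y ord0 i| <= 1) (adjacent x y).
Proof. exact: forallP. Qed.

Lemma adjacent_sym x y : adjacent x y = adjacent y x.
Proof. by apply: eq_forallb => i; rewrite distrC. Qed.

Lemma cliqueP t : reflect {in t &, forall x y, adjacent x y} (clique t).
Proof. exact: allrelP. Qed.

Lemma clique_closed : mem_closed clique.
Proof. by move=> t u ut /cliqueP tP; apply/cliqueP => x y /ut xt /ut; apply: tP. Qed.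

Lemma clique_push (c c' : point -> point) t :
  (forall x y, adjacent x y -> adjacent (c x) (c y) /\ adjacent (c' x) (c' y)) ->
  (forall x y, adjacent x y -> adjacent (c x) (c' y)) ->
  clique t -> clique (map c t ++ map c' t).
Proof.
move=> cn cc' /cliqueP tP; apply/cliqueP => x y.
rewrite !mem_cat => /orP[]/mapP[x' xt ->] /orP[]/mapP[y' yt ->].
- by case: (cn x' y' (tP _ _ xt yt)).
- exact: cc' (tP _ _ xt yt).
- by rewrite adjacent_sym; apply: cc' (tP _ _ yt xt).
- by case: (cn x' y' (tP _ _ xt yt)).
Qed.

(** Coordinatewise retraction onto the cube of radius M around p: constant at M = 0, and fixing any
    given point once M is large. *)
Definition clip p (M : nat) x : point :=
  \row_i clamp (p ord0 i) M (x ord0 i).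

Lemma box_fills B p : B p -> (forall x M, B x -> B (clip p M x)) ->
  forall k, fills (fun t => clique t && all B t) k.
Proof.
move=> Bp Bclip; apply: (contractible_fills (c := clip p) (p := p)).
- move=> t u ut /andP[tc /allP tB]; rewrite (clique_closed ut tc) /=.
  by apply/allP=> x /ut/tB.
- rewrite /= Bp /= !andbT; apply/cliqueP => x y; rewrite !inE => /eqP-> /eqP->.
  by apply/adjacentP=> i; rewrite subrr.
- move=> M t /andP[tc /allP tB]; apply/andP; split.
    apply: clique_push tc => x y /adjacentP xy; first split; apply/adjacentP => i;
      by move: (xy i); rewrite !mxE /clamp; lia.
  rewrite all_cat; apply/andP; split; apply/allP=> _ /mapP[x /tB xB ->];
    exact: Bclip.
- by move=> x; apply/matrixP=> a i; rewrite !mxE clamp0 (ord1 a).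
- move=> x; exists (\sum_i `|x ord0 i - p ord0 i|)%N => M xM.
  apply/matrixP=> a i; rewrite !mxE clamp_id ?(ord1 a) //.
  by apply: leq_trans xM; rewrite (bigD1 i) //= leq_addr.
Qed.

Variable N : int.
Hypothesis N_gt0 : 0 < N.

(** * Acyclicity of shells below their top dimension *)

Definition above i t := all (fun x : point => N <= x ord0 i) t.
Definition below i t := all (fun x : point => x ord0 i <= - N) t.

(* The first [j] coordinates give a polyhedral [j.-1]-sphere; the coordinates
   in [J] are only confined to a half-line. *)
Definition shell (j : nat) (J : {set 'I_n}) t :=
  [&& clique t, all (fun x : point => [forall i in J, N <= x ord0 i]) t &
      [exists i : 'I_n, (i < j)%N && (above i t || below i t)]].

Lemma shell_closed j J : mem_closed (shell j J).
Proof.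
move=> t u ut /and3P[tc /allP tJ /existsP[i /andP[ij ti]]].
rewrite /shell (clique_closed ut tc) /=; apply/andP; split.
  by apply/allP=> x /ut/tJ.
apply/existsP; exists i; rewrite ij /=; apply/orP.
by case/orP: ti => /allP ti; [left|right]; apply/allP=> x /ut/ti.
Qed.

Definition corner (i0 : 'I_n) (a : int) : point := \row_i if i == i0 then a else N.

Lemma above_fills i0 (J : {set 'I_n}) k :
  fills (fun t => clique t && all (fun x : point => [forall i in J, N <= x ord0 i] && (N <= x ord0 i0)) t) k.
Proof.
apply: (@box_fills _ (corner i0 N)).
  by rewrite !mxE eqxx lexx andbT; apply/forall_inP=> i _; rewrite !mxE if_same.
move=> x M /andP[/forall_inP xJ x0]; apply/andP; split.
  by apply/forall_inP=> i /xJ; rewrite !mxE if_same /clamp; lia.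
by rewrite !mxE eqxx /clamp; lia.
Qed.

Lemma below_fills i0 (J : {set 'I_n}) k : i0 \notin J ->
  fills (fun t => clique t && all (fun x : point => [forall i in J, N <= x ord0 i] && (x ord0 i0 <= - N)) t) k.
Proof.
move=> i0J; apply: (@box_fills _ (corner i0 (- N))).
  rewrite !mxE eqxx lexx andbT; apply/forall_inP=> i iJ; rewrite !mxE.
  by case: eqP iJ i0J => // -> ->.
move=> x M /andP[/forall_inP xJ x0]; apply/andP; split.
  apply/forall_inP=> i iJ; have := xJ i iJ; rewrite !mxE /clamp.
  by case: eqP iJ i0J => [-> ->//|_ _ _]; lia.
by rewrite !mxE eqxx /clamp; lia.
Qed.

Definition lower i0 (M : nat) x : point :=
  \row_i if i == i0 then Num.min (x ord0 i) (M%:Z - N) else x ord0 i.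

(** The shell puts no condition on coordinate [i0], so lowering that coordinate stays inside. At M =
    0 all vertices are in the half-space of [low], where cycles bound. *)
Lemma lower_retract (j : nat) (J : {set 'I_n}) i0 k z :
    i0 \notin J -> (j <= i0)%N ->
    let low t := clique t &&
      all (fun x => [forall i in J, N <= x ord0 i] && (x ord0 i0 <= - N)) t in
    let valid t := shell j J t || low t in
    chain_in valid k z -> cycle_chain z ->
  exists2 y, chain_in valid k.+1 y & chain_eq (bd y) z.
Proof.
move=> i0J ji0 low valid zk zc.
have low_closed : mem_closed low.
  move=> t u ut /andP[tc /allP tB]; rewrite /low (clique_closed ut tc) /=.
  by apply/allP=> x /ut/tB.
have vclosed : mem_closed valid.
  move=> t u ut /orP[tv|tv]; apply/orP; [left|right].
    exact: shell_closed ut tv.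
  exact: low_closed ut tv.
have lowerE i M x : i != i0 -> (lower i0 M x) ord0 i = x ord0 i.
  by rewrite mxE => /negPf->.
have lowerJ M x : [forall i in J, N <= x ord0 i] ->
    [forall i in J, N <= lower i0 M x ord0 i].
  move=> /forall_inP xJ; apply/forall_inP=> i iJ; rewrite lowerE ?xJ //.
  by apply: contraNneq i0J => <-.
have [|x|y yk yE] := retract_cycle (c := lower i0) vclosed _ _ zk zc.
- move=> M t tv.
  have tcl : clique (map (lower i0 M.+1) t ++ map (lower i0 M) t).
    have tc : clique t by case/orP: tv => [/and3P[]|/andP[]].
    apply: clique_push tc => x y /adjacentP xy; first split; apply/adjacentP => i;
      by move: (xy i); rewrite !mxE; case: eqP => // _; lia.
  case/orP: tv => [/and3P[_ /allP tJ /existsP[i /andP[ij ti]]]|/andP[_ /allP tB]].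
    have ii0 : i != i0 by apply: contraTneq ij => ->; rewrite -leqNgt.
    apply/orP; left; apply/and3P; split=> //.
      by rewrite all_cat; apply/andP; split; apply/allP=> _ /mapP[x /tJ xJ ->];
        apply: lowerJ.
    apply/existsP; exists i; rewrite ij /=; apply/orP.
    by case/orP: ti => /allP ti; [left|right]; rewrite /above /below all_cat;
      apply/andP; split; apply/allP=> _ /mapP[x /ti xi ->]; rewrite /= lowerE.
  apply/orP; right; rewrite /low tcl /= all_cat.
  by apply/andP; split; apply/allP=> _ /mapP[x /tB /andP[xJ x0] ->]; rewrite lowerJ //=
    mxE eqxx; lia.
- exists (absz (x ord0 i0 + N)) => M xM; apply/matrixP=> a i; rewrite !mxE (ord1 a).
  by case: eqP => // ->; apply: min_shift_id.
have [|w wk wE] := @below_fills i0 J k i0J (map (map (lower i0 0)) z) _ (map_cycle _ zc).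
  apply/chain_inP=> _ /mapP[t tz ->]; rewrite size_map.
  move/chain_inP: zk => /(_ _ tz)[tv ->]; split=> //.
  have tc : clique t by case/orP: tv => [/and3P[]|/andP[]].
  apply/andP; split.
    apply: clique_closed (clique_push (c := lower i0 0) (c' := lower i0 0) _ _ tc).
    - by move=> x xt; rewrite mem_cat xt.
    - move=> x x' /adjacentP xy; split; apply/adjacentP=> i;
        by move: (xy i); rewrite !mxE; case: eqP => // _; lia.
    - move=> x x' /adjacentP xy; apply/adjacentP=> i;
        by move: (xy i); rewrite !mxE; case: eqP => // _; lia.
  apply/allP=> _ /mapP[x xt ->]; rewrite lowerJ /=.
    by rewrite mxE eqxx; lia.
  by case/orP: tv => [/and3P[_ /allP tJ _]|/andP[_ /allP /(_ _ xt)/andP[]]] //; apply: tJ.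
exists (y ++ w).
  rewrite chain_in_cat yk; apply/chain_inP=> t.
  by move/chain_inP: wk => /[apply] -[tv ->]; split=> //; apply/orP; right.
by move=> f; rewrite ev_bd ev_cat -!ev_bd yE wE; xor.
Qed.

(* Mayer-Vietoris: the part of a cycle inside the half-space [above i0] has its
   boundary in a shell with one coordinate less; after filling that boundary,
   both halves lie in contractible complexes. *)
Lemma shell_fills (j k : nat) (J : {set 'I_n}) : (j <= n)%N ->
  (forall i, i \in J -> (j <= i)%N) -> (k < j)%N -> fills (shell j J) k.
Proof.
elim: j k J => // j IH k J jn Jj kj z zk zc.
pose i0 := Ordinal jn.
have i0J : i0 \notin J by apply/negP=> /Jj; rewrite ltnn.
pose zp := [seq t <- z | above i0 t]; pose zm := [seq t <- z | ~~ above i0 t].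
have zE f : ev f z = ev f zp + ev f zm.
  by rewrite /ev !big_filter [LHS](bigID (above i0)).
have bdE : chain_eq (bd zm) (bd zp).
  by move=> f; move: (zc f); rewrite ev_bd zE ev_nil !ev_bd; case: (ev _ _) (ev _ _) => [] [].
have zP t : t \in z -> [/\ clique t, size t = k,
    all (fun x => [forall i in J, N <= x ord0 i]) t & above i0 t || (shell j J t || below i0 t)].
  move/chain_inP: zk => /[apply] -[/and3P[tc tJ /existsP[i /andP[ij ti]]] tk].
  split=> //; move: ij; rewrite ltnS leq_eqVlt => /predU1P[ij|ij].
    have -> : i0 = i by apply: val_inj.
    by case/orP: ti => ->; rewrite ?orbT.
  apply/orP; right; apply/orP; left; rewrite /shell tc tJ.
  by apply/existsP; exists i; rewrite ij.
have [y yk yE] : exists2 y, chain_in (shell j (i0 |: J)) k y & chain_eq (bd y) (bd zp).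
  case: k kj {zk} zP => [_|k kj] zP.
    exists [::] => // f; rewrite !ev_bd ev_nil; apply/esym.
    rewrite (eq_in_ev (g := fun=> false)) ?ev0 // => t.
    by rewrite mem_filter => /andP[_ /zP[_ /size0nil-> _ _]]; rewrite cob_nil.
  (* A tuple that survives reduction occurs in the boundaries of both [zp] and [zm], so it is a face
     of a tuple in each half. *)
  have [w wE wodd] := mod2_reduce (bd zp).
  have wc : cycle_chain w by move=> f; rewrite ev_bd wE -ev_bd bd_bd.
  have [||||y yk yE] := IH k (i0 |: J) _ _ _ w _ wc.
  - exact: ltnW.
  - by move=> i; rewrite !inE => /predU1P[->//|/Jj/ltnW].
  - by [].
  - apply/chain_inP=> u uw.
    have zpu : (u \in bd zp).
      by rewrite -has_pred1 has_count; case: count (wodd u uw).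
    have zmu : (u \in bd zm).
      rewrite -has_pred1 has_count.
      by move: (wodd u uw); rewrite -!ev_pred1 -bdE ev_pred1; case: count.
    have [t] := mem_bd zpu; rewrite mem_filter => /andP[tp /zP[tc tk tJ _]] ut.
    have [t'] := mem_bd zmu; rewrite mem_filter => /andP[/negPf tm /zP[_ _ _ t'v]] ut'.
    rewrite {}tm /= in t'v.
    split; last by move: (mem_faces_size ut); rewrite tk => -[].
    have {}ut := mem_faces_subset ut; have {}ut' := mem_faces_subset ut'.
    apply/and3P; split.
    + exact: clique_closed ut tc.
    + apply/allP=> x /ut xt; apply/forall_inP=> i; rewrite !inE => /predU1P[->|].
        exact: (allP tp).
      by move: i; apply/forall_inP; apply: (allP tJ).
    + case/orP: t'v => [t's|/allP t'b].
        by have /and3P[] := shell_closed ut' t's.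
      (* As N > 0, no vertex is both above and below; the empty tuple is in the shell through any
         coordinate below j. *)
      have u0 : u = [::].
        case: u ut ut' {uw zpu zmu} => // x u ut ut'.
        have := allP tp x (ut x (mem_head _ _)).
        by have := t'b x (ut' x (mem_head _ _)); move: N_gt0 => /=; lia.
      apply/existsP; exists (Ordinal (leq_ltn_trans (leq0n _) jn)).
      by rewrite u0 /= andbT; lia.
  by exists y => // f; rewrite yE wE.
(* The chain y closes up both halves: its coordinate [i0] is at least N, and it lies in the shell
   with one coordinate less. *)
have [||y1 y1k y1E] := @above_fills i0 J k (zp ++ y).
- rewrite chain_in_cat; apply/andP; split; apply/chain_inP=> t.
    rewrite mem_filter => /andP[/allP tp /zP[tc tk /allP tJ _]].
    by split=> //; rewrite tc; apply/allP=> x xt; rewrite tJ // tp.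
  move/chain_inP: yk => /[apply] -[/and3P[tc /allP tJ _] tk]; split=> //.
  rewrite tc; apply/allP=> x /tJ/forall_inP xJ.
  rewrite xJ ?setU11 // andbT; apply/forall_inP=> i iJ.
  by rewrite xJ // setU1r.
- by move=> f; rewrite ev_bd ev_cat -!ev_bd yE ev_nil; xor.
have [||y2 y2k y2E] := @lower_retract j J i0 k (zm ++ y) i0J (leqnn _).
- rewrite chain_in_cat; apply/andP; split; apply/chain_inP=> t.
    rewrite mem_filter => /andP[/negPf tm /zP[tc tk /allP tJ]]; rewrite tm /=.
    case/orP=> [->//|/allP tb]; split=> //; rewrite tc.
    by apply/orP; right; apply/allP=> x xt; rewrite tJ // tb.
  move/chain_inP: yk => /[apply] -[/and3P[tc /allP tJ ti] tk]; split=> //.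
  apply/orP; left; apply/and3P; split=> //; apply/allP=> x /tJ/forall_inP xJ.
  by apply/forall_inP=> i iJ; rewrite xJ // setU1r.
- by move=> f; rewrite ev_bd ev_cat -!ev_bd yE bdE ev_nil; xor.
exists (y1 ++ y2); last first.
  by move=> f; rewrite ev_bd ev_cat -!ev_bd y1E y2E !ev_cat zE; xor.
rewrite chain_in_cat; apply/andP; split; apply/chain_inP=> t.
  move/chain_inP: y1k => /[apply] -[/andP[tc /allP tB] tk]; split=> //.
  rewrite /shell tc /=; apply/andP; split; first by apply/allP=> x /tB/andP[].
  apply/existsP; exists i0; rewrite ltnSn /=; apply/orP; left.
  by apply/allP=> x /tB/andP[].
move/chain_inP: y2k => /[apply] -[/orP[/and3P[tc tJ /existsP[i /andP[ij ti]]]|/andP[tc /allP tB]] tk];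
  split=> //; apply/and3P; split=> //.
- by apply/existsP; exists i; rewrite ti andbT ltnW.
- by apply/allP=> x /tB/andP[].
- apply/existsP; exists i0; rewrite ltnSn /=; apply/orP; right.
  by apply/allP=> x /tB/andP[].
Qed.

End Grid.
(** * Colourings from covers of the sphere *)

Section Sphere.

Variables (R : realType) (h : nat).
Implicit Types (x y : 'rV[R]_h.+1) (U : set (sphere R h)).

Lemma sqr_sum_continuous :
  continuous (fun x : 'rV[R]_h.+1 => \sum_(i < h.+1) x ord0 i ^+ 2).
Proof.
apply: (continuous_big (P := xpredT) (x0 := 0)) => [|i _].
  exact: add_continuous.
move=> x; apply: (@continuousM _ _ (fun x => x ord0 i) (fun x => x ord0 i));
  exact: coord_continuous.
Qed.

Lemma sphere_compact : compact (sphere R h).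
Proof.
apply: (@subclosed_compact _ _
    [set x : 'rV[R]_h.+1 | forall i, `[-1, 1]%classic (x ord0 i)]).
- have -> : sphere R h =
    (fun x : 'rV[R]_h.+1 => \sum_(i < h.+1) x ord0 i ^+ 2) @^-1` [set 1] by [].
  by apply: preimage_closed => [x _|]; [exact: sqr_sum_continuous|exact: closed_eq].
- by apply: (@rV_compact R h.+1 (fun=> `[-1, 1]%classic)) => i; exact: segment_compact.
- move=> x xS i /=; rewrite in_itv /=.
  suff : x ord0 i ^+ 2 <= 1 by nra.
  by rewrite -xS (bigD1 i) //= lerDl sumr_ge0 // => k _; exact: sqr_ge0.
Qed.

Lemma open_sphereP U (s : sphere R h) : open U -> U s ->
  exists2 r : R, 0 < r &
    forall s' : sphere R h, ball (set_val s) r (set_val s') -> U s'.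
Proof.
case=> V oV <- /= Vs.
have : nbhs (set_val s) V by exact: open_nbhs_nbhs.
by case/nbhs_ballP=> r /= r0 rV; exists r => // s' /rV.
Qed.

(** Each point gets a ball whose double fits in a member of F. Finitely many balls cover, and by the
    triangle inequality the least radius serves everywhere. *)
Lemma lebesgue_number (F : set (set (sphere R h))) :
    (forall U, F U -> open U) -> \bigcup_(U in F) U = [set: sphere R h] ->
  exists (Us : seq (set (sphere R h))) (e : R), [/\ 0 < e,
    forall U, U \in Us -> F U &
    forall s : sphere R h, exists2 U, U \in Us &
      forall s' : sphere R h, ball (set_val s) e (set_val s') -> U s'].
Proof.
move=> Fo Fcov.
have /choice[u uP] : forall s : sphere R h, exists Ur : set (sphere R h) * R,
    [/\ F Ur.1, 0 < Ur.2 & forall s' : sphere R h,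
      ball (set_val s) (Ur.2 + Ur.2) (set_val s') -> Ur.1 s'].
  move=> s; have [U FU Us] : (\bigcup_(U in F) U) s by rewrite Fcov.
  have [r r0 rU] := open_sphereP (Fo _ FU) Us.
  by exists (U, r / 2); split; rewrite //= ?divr_gt0 // -splitr.
have := sphere_compact; rewrite compact_cover.
move=> /(_ (sphere R h) setT (fun s => ball (set_val s) (u s).2)).
case=> [s _|x xS|D _ Dcov].
- by apply: ball_open; have [] := uP s.
- exists (SigSub (mem_set xS)) => //; rewrite set_valE /=; apply: ballxx.
  by have [] := uP (SigSub (mem_set xS)).
exists [seq (u s).1 | s <- finmap.enum_fset D].
exists (\big[Order.min/1]_(s <- finmap.enum_fset D) (u s).2); split.
- by elim/big_ind: _ => // [a b a0 b0|s _]; [rewrite lt_min a0|have [] := uP s].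
- by move=> _ /mapP[s _ ->]; have [] := uP s.
- move=> s; have [s0 s0D s0s] := Dcov (set_val s) (set_valP s).
  exists (u s0).1; first by apply/mapP; exists s0.
  move=> s' ss'; have [_ _] := uP s0; apply; apply: ball_triangle s0s _.
  apply: le_ball ss'; exact: ge_bigmin_seq.
Qed.

End Sphere.

(** * Central projection of grid points *)

Section CentralProjection.

Variables (R : realType) (h : nat).
Implicit Types (x y : 'rV[int]_h.+1).

Definition eucl x : R := Num.sqrt (\sum_(i < h.+1) (x ord0 i)%:~R ^+ 2).

Definition central x : 'rV[R]_h.+1 := (eucl x)^-1 *: map_mx intr x.

Lemma eucl_sqr x : eucl x ^+ 2 = \sum_(i < h.+1) (x ord0 i)%:~R ^+ 2.
Proof. by rewrite sqr_sqrtr // sumr_ge0 // => i _; exact: sqr_ge0. Qed.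

Lemma eucl_ge x i : `|(x ord0 i)%:~R| <= eucl x.
Proof.
rewrite -(ler_pXn2r (n := 2)) ?nnegrE ?sqrtr_ge0 // eucl_sqr.
rewrite (bigD1 i) //= real_normK ?num_real // lerDl sumr_ge0 // => k _.
exact: sqr_ge0.
Qed.

Lemma central_sphere x : 0 < eucl x -> sphere R h (central x).
Proof.
move=> x0; rewrite /sphere /=.
under eq_bigr do rewrite !mxE exprMn.
by rewrite -mulr_sumr -eucl_sqr -exprMn mulVf ?expr1n // gt_eqF.
Qed.

Lemma centralN x : central (- x) = - central x.
Proof.
rewrite /central map_mxN scalerN; congr (- (_^-1 *: _)).
by rewrite /eucl; under eq_bigr do rewrite mxE rmorphN sqrrN.
Qed.

(** The squares differ by at most h + 1 times the sum of the norms, a factor that is then divided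
    out. *)
Lemma eucl_near x y : adjacent x y -> 0 < eucl x ->
  `|eucl x - eucl y| <= h.+1%:R.
Proof.
move=> /adjacentP xy x0.
have y0 : 0 <= eucl y by exact: sqrtr_ge0.
have : `|eucl x ^+ 2 - eucl y ^+ 2| <= h.+1%:R * (eucl x + eucl y).
  rewrite !eucl_sqr -sumrB; apply: le_trans (ler_norm_sum _ _ _) _.
  apply: le_trans (ler_sum _ (G := fun=> eucl x + eucl y) _) _ => [i _|].
    rewrite subr_sqr normrM -[leRHS]mul1r ler_pM //.
      by rewrite -rmorphB -intr_norm lerz1 xy.
    by apply: le_trans (ler_normD _ _) _; rewrite lerD ?eucl_ge.
  by rewrite sumr_const card_ord mulr_natl.
rewrite subr_sqr normrM [X in _ * X <= _]ger0_norm ?ler_pM2r //.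
  by rewrite ltr_wpDr.
by rewrite addr_ge0 // ltW.
Qed.

Lemma central_near x y i (N : R) : adjacent x y -> 0 < N -> N <= eucl x ->
  0 < eucl y -> `|central x ord0 i - central y ord0 i| <= h.+2%:R / N.
Proof.
move=> xy N0 Nx y0; have x0 : 0 < eucl x by exact: lt_le_trans Nx.
rewrite !mxE.
(* In the numerator, the first difference is at most 1, and the second term is at most h + 1 by
   [eucl_near]. *)
have -> : (eucl x)^-1 * (x ord0 i)%:~R - (eucl y)^-1 * (y ord0 i)%:~R =
  (((x ord0 i)%:~R - (y ord0 i)%:~R) -
   ((y ord0 i)%:~R / eucl y) * (eucl x - eucl y)) / eucl x :> R.
  by field; rewrite !gt_eqF.
rewrite normrM normfV (gtr0_norm x0); apply: ler_pM => //.
- by rewrite invr_ge0 ltW.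
- apply: le_trans (ler_normB _ _) _; rewrite -natr1 addrC lerD //.
    rewrite normrM -[leRHS]mul1r ler_pM // ?eucl_near //.
    by rewrite normrM normfV (gtr0_norm y0) ler_pdivrMr // mul1r eucl_ge.
  by rewrite -rmorphB -intr_norm lerz1; move/adjacentP: xy.
- by rewrite lef_pV2.
Qed.

End CentralProjection.

Lemma rV_ballP (R : realType) (n : nat) (x y : 'rV[R]_n) (e : R) : 0 < e ->
  (forall i, `|x ord0 i - y ord0 i| < e) -> ball x e y.
Proof. by move=> e0 xy; split=> // i j; rewrite (ord1 i : i = ord0); apply: xy. Qed.

Lemma uniq_size_card (T : choiceType) (A : set T) (n : nat) (s : seq T) :
  A #<= `I_n -> uniq s -> (forall x, x \in s -> A x) -> (size s <= n)%N.
Proof.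
move=> An us sA; apply: leq_trans (geq_card_fset_set An).
apply: uniq_leq_size => // x /sA Ax; rewrite in_fset_set ?inE //.
by apply/finite_set_leP; exists n.
Qed.

(** * The lower bound for even spheres *)

Lemma no_cover_even (R : realType) (h l : nat) : (1 < l)%N -> h.+2 = l.*2 ->
  ~ exists F : set (set (sphere R h)), antipodal_cover l F.
Proof.
move=> l1 hl [F [Fo Fcov Fap Fcard]].
have [Us [e [e0 UsF Us_e]]] := lebesgue_number Fo Fcov.
pose inside x U := `[< forall s : sphere R h, ball (central R x) e (set_val s) -> U s >].
(* Without duplicates, different colours name different members of the cover. *)
pose Vs := undup Us.
pose color x := find (inside x) Vs.
(* Large enough that adjacent points of norm at least N project to within e. *)
pose N : nat := (Num.truncn (h.+2%:R / e)).+1.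
have N0 : 0 < N%:Z by [].
have Ne : h.+2%:R / N%:R < e.
  rewrite ltr_pdivrMr ?ltr0n // mulrC -ltr_pdivrMr //.
  exact: truncnS_gt.
pose valid := @shell h.+1 N%:Z h.+1 finset.set0.
have far t x : valid t -> x \in t -> N%:R <= eucl R x.
  case/and3P=> _ _ /existsP[i /andP[_ ti]] xt; apply: le_trans (eucl_ge R x i).
  case/orP: ti => /allP/(_ x xt).
    by rewrite -(ler_int R) => /le_trans; apply; exact: ler_norm.
  by rewrite lerNr -(ler_int R) rmorphN => /le_trans; apply; rewrite -normrN ler_norm.
have eucl_gt0 t x : valid t -> x \in t -> 0 < eucl R x.
  by move=> tv xt; apply: lt_le_trans (far _ _ tv xt); rewrite ltr0n.
have on_sphere t x : valid t -> x \in t ->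
    exists s : sphere R h, set_val s = central R x.
  move=> tv xt.
  by exists (SigSub (mem_set (central_sphere (eucl_gt0 _ _ tv xt)))); rewrite set_valE.
have close t x y : valid t -> x \in t -> y \in t -> ball (central R x) e (central R y).
  move=> tv xt yt; apply: rV_ballP => // i; apply: le_lt_trans Ne.
  apply: central_near; rewrite ?ltr0n ?(far t) ?(eucl_gt0 t) //.
  by case/and3P: tv => /cliqueP tc _ _; apply: tc.
pose U x := nth set0 Vs (color x).
have colorP t x : valid t -> x \in t ->
    [/\ (color x < size Vs)%N, F (U x) &
     forall s : sphere R h, ball (central R x) e (set_val s) -> U x s].
  move=> tv xt; have [s sx] := on_sphere t x tv xt.
  have has_x : has (inside x) Vs.
    have [V VUs Vs_e] := Us_e s; apply/hasP; exists V; first by rewrite mem_undup.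
    by apply/asboolP; rewrite -sx.
  have cx : (color x < size Vs)%N by rewrite -has_find.
  split=> //; first by apply: UsF; rewrite -mem_undup mem_nth.
  by have /asboolP := nth_find set0 has_x.
have valid_opp t : valid t -> valid (map -%R t).
  case/and3P=> /cliqueP tc _ /existsP[i /andP[ij ti]]; apply/and3P; split.
  - apply/cliqueP=> _ _ /mapP[x xt ->] /mapP[y yt ->]; apply/adjacentP=> k.
    by rewrite !mxE -opprD normrN; move/adjacentP: (tc x y xt yt).
  - by apply/allP=> x _; apply/forall_inP=> k; rewrite finset.in_set0.
  - apply/existsP; exists i; rewrite ij /= orbC; apply/orP.
    case/orP: ti => /allP ti; [left|right]; apply/allP=> _ /mapP[x /ti xi ->];
      by rewrite /= mxE ?lerN2 // lerNr.
pose v : 'rV[int]_h.+1 := const_mx N%:Z.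
have vv : valid [:: v].
  apply/and3P; split.
  - by apply/cliqueP=> x y /[!inE] /eqP-> /eqP->; apply/adjacentP=> i; rewrite subrr.
  - by rewrite /= andbT; apply/forall_inP=> k; rewrite finset.in_set0.
  - by apply/existsP; exists ord0; rewrite /= mxE lexx.
have vfill k : (k.+1 < l.*2)%N -> fills valid k.
  move=> kl; apply: shell_fills => //; first by move=> i; rewrite finset.in_set0.
  by lia.
apply: (@no_antipodal_coloring _ valid -%R color l _ _ _ _ _ v l1 vv vfill).
- exact: opprK.
- exact: shell_closed.
- exact: valid_opp.
- move=> t x y tv xt yt cxy.
  have [s sy] := on_sphere t y tv yt.
  have ytv := map_f -%R yt.
  have [s' s'y] := on_sphere _ _ (valid_opp _ tv) ytv.
  have [_ FU Ux] := colorP t x tv xt.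
  have [_ _ Uy] := colorP _ _ (valid_opp _ tv) ytv.
  (* [U x] would contain the projection of y, which is close to that of x, and also its antipode. *)
  apply: (Fap _ FU s s').
  + by apply: Ux; rewrite sy; apply: close xt yt.
  + by rewrite /U cxy; apply: Uy; rewrite s'y; apply: ballxx.
  + by rewrite s'y sy centralN.
- move=> t tv tl; apply/negP=> tu.
  case: t tv tl tu => // x0 t tv tl tu.
  have [s sx] := on_sphere _ _ tv (mem_head x0 t).
  (* With l + 1 different colours, l + 1 members of the cover would contain the projection of
     [x0]. *)
  suff : (size (map U (x0 :: t)) <= l)%N by rewrite size_map tl ltnn.
  apply: uniq_size_card (Fcard s) _ _.
  + rewrite -/(map U (x0 :: t)) (map_comp (nth set0 Vs) color).
    rewrite map_inj_in_uniq // => _ _ /mapP[x xt ->] /mapP[y yt ->] /eqP.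
    have [cx _ _] := colorP _ _ tv xt; have [cy _ _] := colorP _ _ tv yt.
    by rewrite nth_uniq ?undup_uniq // => /eqP.
  + move=> _ /mapP[x xt ->]; have [_ FU Ux] := colorP _ _ tv xt.
    by split=> //; apply: Ux; rewrite sx; apply: close tv xt (mem_head _ _).
Qed.
Lemma card_le_seq (T : choiceType) (A : set T) (t : seq T) (n : nat) (a : T) :
  (size t <= n)%N -> (forall x, A x -> x \in t) -> A #<= `I_n.
Proof.
move=> tn At; apply: card_le_trans (card_image_le (nth a t) `I_n).
apply: subset_card_le => x /At xt; exists (index x t); last exact: nth_index.
by rewrite /= (leq_trans _ tn) // index_mem.
Qed.

(** * The upper bound *)

Section UpperBound.

Variables (R : realType) (h r : nat).
Implicit Types (x : 'rV[R]_h.+1) (s : sphere R h) (i : 'I_h.+2).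

(* The coordinates of a point together with minus their sum: [h.+2] linear
   forms adding up to zero. *)
Definition form x i : R :=
  if unlift ord_max i is Some k then x ord0 k else - \sum_k x ord0 k.

Lemma formN x i : form (- x) i = - form x i.
Proof.
rewrite /form; case: unlift => [k|]; first by rewrite mxE.
congr (- _); rewrite -sumrN; apply: eq_bigr => k _.
by rewrite mxE.
Qed.

Lemma form_continuous i : continuous (fun s : sphere R h => form (set_val s) i).
Proof.
have valc k : continuous (fun s : sphere R h => (set_val s) ord0 k).
  move=> s; apply: (@continuous_comp _ _ _ set_val (fun x : 'rV[R]_h.+1 => x ord0 k)).
    exact: initial_continuous.
  exact: coord_continuous.
rewrite /form; case: unlift => [k|] s; first exact: valc.
apply: (@continuousN _ _ _ (fun s : sphere R h => \sum_k set_val s ord0 k)).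
by apply: (@continuous_big _ _ +%R 0 xpredT) => // ; exact: add_continuous.
Qed.

Lemma nbhs_form_gt a s i : a < form (set_val s) i ->
  \forall s' \near s, a < form (set_val s') i.
Proof.
move=> asi; apply: open_nbhs_nbhs; split => //.
apply: (@open_comp _ _ (fun s : sphere R h => form (set_val s) i) [set y | a < y]).
  by move=> ? _; exact: form_continuous.
exact: open_gt.
Qed.

Lemma nbhs_form_lt a s i : form (set_val s) i < a ->
  \forall s' \near s, form (set_val s') i < a.
Proof.
move=> asi; apply: open_nbhs_nbhs; split => //.
apply: (@open_comp _ _ (fun s : sphere R h => form (set_val s) i) [set y | y < a]).
  by move=> ? _; exact: form_continuous.
exact: open_lt.
Qed.

Definition level : R := (h.+2%:R ^+ 2)^-1.

Lemma level_gt0 : 0 < level.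
Proof. by rewrite invr_gt0 exprn_gt0 ?ltr0n. Qed.

(** Otherwise all coordinates are at most [level] and, because minus their sum is too, at least
    -1/(h+2). Their squares then add up to at most (h+1)/(h+2)^2 < 1. *)
Lemma form_gt_level s : exists i, level < form (set_val s) i.
Proof.
apply: contrapT => /forallNP sN; have := set_valP s; rewrite /sphere /=.
set x := set_val s in sN *.
have form_le i : form x i <= level by rewrite leNgt; apply/negP/sN.
have x_le k : x ord0 k <= level.
  by have := form_le (lift ord_max k); rewrite /form liftK.
have x_ge k : - h.+2%:R^-1 <= x ord0 k.
  have := form_le ord_max; rewrite /form unlift_none (bigD1 k) //= opprD.
  have : \sum_(i < h.+1 | i != k) x ord0 i <= h.+1%:R * level.
    apply: (@le_trans _ _ (\sum_(i < h.+1 | i != k) level)); first exact: ler_sum.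
    rewrite sumr_const -[leLHS]mulr_natl ler_pM2r ?level_gt0 // ler_nat.
    by apply: leq_trans (max_card _) _; rewrite card_ord.
  have -> : h.+2%:R^-1 = (h.+1%:R + 1) * level :> R.
    by rewrite natr1 /level expr2 invfM mulrA mulfV ?mul1r // pnatr_eq0.
  by lra.
have x_sqr k : x ord0 k ^+ 2 <= (h.+2%:R^-1) ^+ 2.
  have : level <= h.+2%:R^-1.
    by rewrite /level expr2 invfM ler_piMr ?invr_ge0 // invf_le1 ?ltr0n // ler1n.
  move=> lev; have xk := le_trans (x_le k) lev.
  by rewrite -subr_ge0 subr_sqr mulr_ge0 ?subr_ge0 // addrC -lerBlDr sub0r.
move=> x1; have : (1 : R) <= h.+1%:R * h.+2%:R^-1 ^+ 2.
  rewrite -[leLHS]x1; apply: le_trans (ler_sum _ (fun k _ => x_sqr k)) _.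
  by rewrite sumr_const card_ord mulr_natl.
apply/negP; rewrite -ltNge exprVn ltr_pdivrMr ?exprn_gt0 ?ltr0n // mul1r.
by rewrite -natrX ltr_nat expnS; apply: leq_trans (leq_pmulr _ _).
Qed.

Definition many : set (sphere R h) :=
  [set s : sphere R h | (r.+2 <= #|[pred i | (0 < form (set_val s) i)%R]|)%N].

(** The choice of strict and weak inequalities makes this set open: a form below the level stays
    below it nearby, so the count cannot grow. *)
Definition few i : set (sphere R h) :=
  [set s : sphere R h | level < form (set_val s) i /\
           (#|[pred j | (level <= form (set_val s) j)%R]| <= r.+1)%N].

Lemma many_open : open many.
Proof.
rewrite openE => s sm; rewrite /interior /=.
have pos i : \forall s' \near s,
    0 < form (set_val s) i -> 0 < form (set_val s') i.
  have [pos|_] := boolP (0 < form (set_val s) i); last first.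
    by apply: (@nearW _ (nbhs s)).
  by apply: (@filterS _ (nbhs s)) (nbhs_form_gt pos).
have := @filter_forall _ _ _ (nbhs s) (nbhs_filter s) pos.
apply: (@filterS _ (nbhs s)) => s' ss'; apply: leq_trans sm _.
by apply/subset_leq_card/fintype.subsetP => i; rewrite !inE => /ss'.
Qed.

Lemma few_open i : open (few i).
Proof.
rewrite openE => s [si sf]; rewrite /interior /=.
have neg j : \forall s' \near s,
    form (set_val s) j < level -> form (set_val s') j < level.
  have [neg|_] := boolP (form (set_val s) j < level); last first.
    by apply: (@nearW _ (nbhs s)).
  by apply: (@filterS _ (nbhs s)) (nbhs_form_lt neg).
have := @filter_forall _ _ _ (nbhs s) (nbhs_filter s) neg.
apply: (@filterS2 _ (nbhs s)) (nbhs_form_gt si) => s' s'i ss'; split=> //.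
apply: leq_trans sf; apply/subset_leq_card/fintype.subsetP => j; rewrite !inE.
by apply: contraTT; rewrite -!ltNge; apply: ss'.
Qed.

(** No form is positive at both x and -x, and 2(r + 2) exceeds the number 2r + 2 of forms. *)
Lemma many_antipode_free : h = r.*2 -> antipode_free many.
Proof.
move=> hr x y xm ym yx.
have := leq_add xm ym; rewrite yx /many /= -cardUI.
set P := [pred i | _]; set Q := [pred i | _].
rewrite (eq_card0 (A := [predI P & Q])) => [|i]; last first.
  by rewrite !inE formN oppr_gt0; case: ltgtP.
rewrite addn0 => /leq_trans/(_ (max_card _)); rewrite card_ord; lia.
Qed.

Lemma few_antipode_free i : antipode_free (few i).
Proof.
move=> x y [xi _] [yi _] yx; move: yi; rewrite yx formN.
by have := level_gt0; lra.
Qed.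

Lemma Qprop_even : h = r.*2 -> Qprop R h r.+2.
Proof.
move=> hr; exists (many |` range few); split.
- by move=> _ [->|[i _ <-]]; [exact: many_open|exact: few_open].
- apply/seteqP; split=> // s _.
  (* If r + 2 forms reach the level they are positive; otherwise a form above the level gives a set
     [few i]. *)
  have [mf|fm] := leqP r.+2 #|[pred j | level <= form (set_val s) j]|.
    exists many; [by left|apply: leq_trans mf _].
    apply/subset_leq_card/fintype.subsetP => j; rewrite !inE.
    exact: lt_le_trans level_gt0.
  by have [i si] := form_gt_level s; exists (few i); [right; exists i|].
- by move=> _ [->|[i _ <-]]; [exact: many_antipode_free|exact: few_antipode_free].
move=> s.
(* One set for [many], and at most r + 1 sets [few i], since each such i is a form that reaches the
   level. *)
apply: (@card_le_seq _ _ (many :: [seq few i | i <- enum [pred i | `[< few i s >]]]) _ many).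
  rewrite /= size_map -cardE ltnS.
  have [->//|/card_gt0P[i]] := posnP #|[pred i | `[< few i s >]]|.
  rewrite inE => -[_ si]; apply: leq_trans si.
  apply/subset_leq_card/fintype.subsetP => j; rewrite !inE => -[lj _].
  exact: ltW.
move=> U [[->|[i _ <-]] sU]; first by rewrite inE eqxx.
rewrite inE; apply/orP; right; apply/mapP; exists i => //.
by rewrite mem_enum inE.
Qed.

End UpperBound.

Local Close Scope ring_scope.
Local Close Scope card_scope.
Local Close Scope classical_set_scope.

Theorem theorem2p2 (R : realType) :
  (forall l : nat, (2 <= l)%N ->
     ~ exists F : set (set (sphere R (2 * l - 2))), antipodal_cover l F) /\
  (forall h : nat, (2 <= h)%N -> ~~ odd h -> Qmin R h = (h %/ 2 + 2)%N).
Proof.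
split=> [l l2|h h2 h_even]; first by apply: no_cover_even => //; lia.
have hr : h = (h %/ 2).*2 by lia.
(* A smaller m is at most l = h/2 + 1, for which h + 2 = 2l, so the lower bound applies. *)
have Qlow m : Qprop R h m -> (h %/ 2 + 2 <= m)%N.
  move=> [F [Fo Fcov Fap Fm]]; rewrite leqNgt; apply/negP => mh.
  apply: (@no_cover_even R h (h %/ 2).+1); [lia|lia|].
  exists F; split=> // x; apply: card_le_trans (Fm x) _.
  by rewrite card_le_II; lia.
have Qup : Qprop R h (h %/ 2 + 2) by rewrite addn2; apply: Qprop_even.
apply: xget_unique => [|m [m1 Qm mmin]].
  by split=> // [|m _]; [rewrite addn2|exact: Qlow].
by apply/eqP; rewrite eqn_leq Qlow // mmin // addn2.
Qed.
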